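(* Let $k$ be a field of characteristic $p\neq 0$ and let $(D,\prec,\succ)$ be a dendriform algebra over $k$. For $x,y\in D$ put $x\star y:=x\prec y+x\succ y$ and $\{x,y\}:=x\succ y-y\prec x$, and let $x^{\star p}$ denote the $p$-th power of $x$ for the associative product $\star$. Then $(D,\{-,-\},(-)^{\star p})$, i.e. $D$ with the product $\{-,-\}$ and the $p$-map $x\mapsto x^{\star p}$, is a restricted pre-Lie algebra.
   Context: A dendriform algebra over a field $k$ is a $k$-vector space $D$ with two bilinear operations $\prec,\succ: D\times D\to D$ such that for all $x,y,z\in D$: $(x\prec y)\prec z=x\prec(y\prec z+y\succ z)$, $(x\succ y)\prec z=x\succ(y\prec z)$, $(x\prec y+x\succ y)\succ z=x\succ(y\succ z)$. It is known that $x\star y:=x\prec y+x\succ y$ is then associative, and that $\{x,y\}:=x\succ y-y\prec x$ is then a (left) pre-Lie product. A (left) pre-Lie algebra is a $k$-vector space $P$ with a bilinear operation $\{-,-\}:P\times P\to P$ such that $\{x,\{y,z\}\}-\{\{x,y\},z\}=\{y,\{x,z\}\}-\{\{y,x\},z\}$ for all $x,y,z\in P$. Then $[x,y]:=\{x,y\}-\{y,x\}$ is a Lie bracket on $P$. A restricted pre-Lie algebra over a field $k$ of characteristic $p\neq 0$ is a pre-Lie algebra $(P,\{-,-\})$ over $k$ together with a map $(-)^{[p]}:P\to P$ (the $p$-map) such that for all $x,y\in P$, $\alpha\in k$: (1) $(\alpha x)^{[p]}=\alpha^p x^{[p]}$; (2) $\{x^{[p]},y\}=\{x,\{x,\cdots\{x,y\}\cdots\}\}$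 ($p$ copies of $x$); (3) $\{y,x^{[p]}\}=\{x,\{x,\cdots\{x,y\}\cdots\}\}-[x,[x,\cdots[x,y]\cdots]]$ ($p$ copies of $x$ in each term); (4) $(x+y)^{[p]}=x^{[p]}+y^{[p]}+\sum_{i=1}^{p-1}s_i(x,y)$, where $[x,y]:=\{x,y\}-\{y,x\}$ and $i\,s_i(x,y)$ is the coefficient of $\lambda^{i-1}$ in $[\lambda x+y,[\cdots,[\lambda x+y,x]\cdots]]$ with $p-1$ copies of $\lambda x+y$ ($\lambda$ a formal variable). *)

(* Defs.v *)
From HB Require Import structures.
From mathcomp Require Import all_boot all_order all_algebra.

Set Implicit Arguments.
Unset Strict Implicit.
Unset Printing Implicit Defensive.

Import GRing.Theory.
Local Open Scope ring_scope.

Definition is_bilinear (k : fieldType) (V : lmodType k) (op : V -> V -> V) :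
    Prop :=
  bilinear_for *:%R *:%R op.

Record is_dendriform (k : fieldType) (D : lmodType k)
    (prec succ : D -> D -> D) : Prop := IsDendriform {
  dend_prec_bilinear : is_bilinear prec;
  dend_succ_bilinear : is_bilinear succ;
  dend_prec_prec : forall x y z,
    prec (prec x y) z = prec x (prec y z + succ y z);
  dend_succ_prec : forall x y z,
    prec (succ x y) z = succ x (prec y z);
  dend_succ_succ : forall x y z,
    succ (prec x y + succ x y) z = succ x (succ y z) }.

Definition dend_star (k : fieldType) (D : lmodType k)
    (prec succ : D -> D -> D) (x y : D) : D :=
  prec x y + succ x y.

Definition dend_brace (k : fieldType) (D : lmodType k)
    (prec succ : D -> D -> D) (x y : D) : D :=
  succ x y - prec y x.

(* The power x * (x * ... (x * x)) with n factors. The product [op] need not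
   have a unit, so the value 0 at n = 0 is a mere convention. *)
Definition op_pow (k : fieldType) (V : lmodType k) (op : V -> V -> V)
    (n : nat) (x : V) : V :=
  iterop n op x 0.

Record is_prelie (k : fieldType) (P : lmodType k)
    (brace : P -> P -> P) : Prop := IsPreLie {
  prelie_bilinear : is_bilinear brace;
  prelie_left_sym : forall x y z,
    brace x (brace y z) - brace (brace x y) z =
    brace y (brace x z) - brace (brace y x) z }.

Definition lie_of (k : fieldType) (P : lmodType k) (brace : P -> P -> P)
    (x y : P) : P :=
  brace x y - brace y x.

(* An element sum_n u_n lambda^n of P[lambda], for a k-module P, is encoded by
   its coefficient sequence u : nat -> P; all the sequences built below have
   finite support. [vpoly_ext op] is the k[lambda]-bilinear extension of [op],
   [vpoly_const x] is the constant x, and [vpoly_lin x y] is lambda x + y. *)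
Definition vpoly_const (k : fieldType) (P : lmodType k) (x : P) : nat -> P :=
  fun n => if n == 0%N then x else 0.

Definition vpoly_lin (k : fieldType) (P : lmodType k) (x y : P) : nat -> P :=
  fun n => if n == 0%N then y else if n == 1%N then x else 0.

Definition vpoly_ext (k : fieldType) (P : lmodType k) (op : P -> P -> P)
    (u v : nat -> P) : nat -> P :=
  fun n => \sum_(i < n.+1) op (u i) (v (n - i)%N).

(* [lambda x + y, [..., [lambda x + y, x]...]] with p - 1 copies of
   lambda x + y. *)
Definition jacobson_poly (k : fieldType) (P : lmodType k)
    (lie : P -> P -> P) (p : nat) (x y : P) : nat -> P :=
  iter p.-1 (vpoly_ext lie (vpoly_lin x y)) (vpoly_const x).

(* i s_i(x, y) is the coefficient of lambda^(i-1); i is only used in the range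
   0 < i < p, where it is invertible in k. *)
Definition jacobson_s (k : fieldType) (P : lmodType k)
    (lie : P -> P -> P) (p i : nat) (x y : P) : P :=
  (i%:R : k)^-1 *: jacobson_poly lie p x y i.-1.

Record is_restricted_prelie (k : fieldType) (p : nat) (P : lmodType k)
    (brace : P -> P -> P) (pmap : P -> P) : Prop := IsRestrictedPreLie {
  rprelie_prelie : is_prelie brace;
  rprelie_pmapZ : forall (a : k) (x : P), pmap (a *: x) = a ^+ p *: pmap x;
  rprelie_pmapl : forall x y, brace (pmap x) y = iter p (brace x) y;
  rprelie_pmapr : forall x y,
    brace y (pmap x) = iter p (brace x) y - iter p (lie_of brace x) y;
  rprelie_pmapD : forall x y,
    pmap (x + y) =
    pmap x + pmap y + \sum_(1 <= i < p) jacobson_s (lie_of brace) p i x y }.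

(* Main.v *)
Require Import Defs.
From HB Require Import structures.
From mathcomp Require Import all_boot all_order all_algebra.

Set Implicit Arguments.
Unset Strict Implicit.
Unset Printing Implicit Defensive.

Import GRing.Theory.
Local Open Scope ring_scope.

(** The proof rests on two facts about a pair of commuting additive operators
    f, g on an abelian group killed by a prime p: as C(p-1, i) = (-1)^i mod p,
    (f - g)^(p-1) is the sum of the f^(p-1-i) g^i ([iterB_pred_pchar]), and
    multiplying by f - g once more, (f - g)^p = f^p - g^p ([iterB_pchar]).

    In a dendriform algebra, write L_x = x succ - and R_x = - prec x. The three
    axioms say that L is multiplicative for star, that R is antimultiplicative,
    and that L_x commutes with R_z. Since {x, -} = L_x - R_x, it follows that
    [{x, -}, {y, -}] = {[x, y], -}, which is the pre-Lie identity, and that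
    {x, -}^p = L_x^p - R_x^p = {x^p, -}, which is the axiom on {x^p, y}. The
    commutator of the brace is that of the associative product star, whose left
    and right multiplications commute too, so that [x, -]^p = [x^p, -]. The
    axiom on {y, x^p} is then {y, x^p} = {x^p, y} - [x^p, y].

    The formula for (x + y)^p is Jacobson's and holds in every associative
    algebra ([jacobson_formula]). For q = a X + b with noncommuting a and b,
    the formal derivative of q^p is the sum of the q^(p-1-i) a q^i, which is
    (ad q)^(p-1) a by the first fact above. Comparing coefficients, i times
    that of X^i in q^p is i s_i, and i is invertible for 0 < i < p, so that the
    coefficient is s_i; the extreme ones are b^p and a^p.
    Evaluating at X = 1 gives the formula. Polynomials are taken over a unital
    ring, hence the passage to the unitization of the algebra. *)

(** * Commuting operators in characteristic p *)

Section CommutingOperators.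
Variable V : zmodType.

Lemma iter_comm (f g : V -> V) n v :
  (forall w, f (g w) = g (f w)) -> f (iter n g v) = iter n g (f v).
Proof. by move=> fgC; elim: n => //= n IHn; rewrite fgC IHn. Qed.

(** The binomial formula in the ring of endomorphisms of V. It gives the powers
    of f - g when applied to the pair f, - g. *)
Lemma iterD_comm (f g : {additive V -> V}) n v :
    (forall w, f (g w) = g (f w)) ->
  iter n (f \+ g) v =
    \sum_(i < n.+1) iter (n - i) f (iter i g v) *+ 'C(n, i).
Proof.
move=> fgC; elim: n => [|n IHn]; first by rewrite big_ord1.
rewrite iterS IHn /= !raddf_sum /= big_ord_recl [in RHS]big_ord_recl /=.
rewrite !subn0 !bin0 -addrA; congr (_ + _).
under [in RHS]eq_bigr => i _ do rewrite /= binS mulrnDr subSS.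
rewrite [in RHS]big_split /= [in RHS]big_ord_recr /= bin_small // addr0.
congr (_ + _); apply: eq_bigr => i _; rewrite raddfMn /=.
  by rewrite -[(n - i)%N]prednK ?subn_gt0 // subnS.
by rewrite (@iter_comm g f) // => w; rewrite fgC.
Qed.

Variable p : nat.
Hypotheses (p_prime : prime p) (pV : forall v : V, v *+ p = 0).

(** Pascal's rule reads C(p-1, i+1) = - C(p-1, i) mod p, so the signs coming
    from - g cancel those of the binomial coefficients C(p-1, i). *)
Lemma iterN_bin_pchar (g : {additive V -> V}) i v : (i < p)%N ->
  iter i (\- g) v *+ 'C(p.-1, i) = iter i g v.
Proof.
elim: i => [|i IHi] ltip; first by rewrite bin0.
have /dvdnP[m binp] := prime_dvd_bin (k := i.+1) p_prime ltip.
rewrite !iterS -(IHi (ltnW ltip)) raddfMn /=.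
apply/eqP; rewrite mulNrn eq_sym -addr_eq0 -mulrnDr addnC -binS.
by rewrite prednK ?prime_gt0 // binp mulnC mulrnA pV mul0rn.
Qed.

Lemma iterB_pred_pchar (f g : {additive V -> V}) v :
    (forall w, f (g w) = g (f w)) ->
  iter p.-1 (f \- g) v = \sum_(i < p) iter (p.-1 - i) f (iter i g v).
Proof.
move=> fgC; have p_gt0 := prime_gt0 p_prime.
rewrite (@iterD_comm f (\- g)) => [|w]; last by rewrite /= raddfN fgC.
rewrite prednK //; apply: eq_bigr => i _.
rewrite -(iterN_bin_pchar g v (ltn_ord i)).
by elim: (p.-1 - i)%N => //= n <-; rewrite raddfMn.
Qed.

(** The sum given by [iterB_pred_pchar] for the first p - 1 iterations
    telescopes under one more application of f - g. *)
Lemma iterB_pchar (f g : {additive V -> V}) v :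
    (forall w, f (g w) = g (f w)) ->
  iter p (f \- g) v = iter p f v - iter p g v.
Proof.
move=> fgC; have p_gt0 := prime_gt0 p_prime.
rewrite -[in LHS](prednK p_gt0) iterS iterB_pred_pchar //=.
pose u i := iter (p - i) f (iter i g v).
have u0 : u 0%N = iter p f v by rewrite /u subn0.
have up : u p = iter p g v by rewrite /u subnn.
rewrite -u0 -up -[RHS]opprB -(telescope_sumr u) // -sumrN big_mkord.
rewrite !raddf_sum -big_split /=.
apply: eq_bigr => i _; rewrite opprB /u -iterS.
congr (_ - _); first by rewrite -subSn ?prednK // -ltnS prednK.
rewrite (@iter_comm g f) => [|w]; last by rewrite fgC.
by rewrite -subn1 -subnDA add1n.
Qed.

End CommutingOperators.

(** * Powers of a linear polynomial with noncommuting coefficients *)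

Lemma deriv_exp_sum (R : nzRingType) (q : {poly R}) n :
  (q ^+ n)^`() = \sum_(i < n) q ^+ (n.-1 - i) * q^`() * q ^+ i.
Proof.
elim: n => [|n IHn]; first by rewrite big_ord0 expr0 derivC.
rewrite exprS derivM IHn big_ord_recr /= subnn expr0 mul1r addrC.
congr (_ + _); rewrite mulr_sumr; apply: eq_bigr => i _.
rewrite !mulrA -exprS; congr (_ ^+ _ * _ * _).
by case: n i {IHn} => [[]|n i] //=; rewrite subSn // -ltnS.
Qed.

Lemma iter_commutator_pred_pchar (R : nzRingType) p (a b : R) :
    p \in [pchar R] ->
  iter p.-1 (fun z => a * z - z * a) b =
    \sum_(i < p) a ^+ (p.-1 - i) * b * a ^+ i.
Proof.
move=> pR.
pose l : {additive R -> R} := a \*o idfun.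
pose r : {additive R -> R} := a \o* idfun.
have killR (z : R) : z *+ p = 0 by rewrite mulrn_pchar.
have lrC w : l (r w) = r (l w) by rewrite /= mulrA.
rewrite (iterB_pred_pchar (pcharf_prime pR) killR (f := l) (g := r)) //.
apply: eq_bigr => i _; rewrite -mulrA.
have -> : iter i r b = b * a ^+ i.
  by elim: (nat_of_ord i) => [|j /= ->]; rewrite ?mulr1 // -mulrA -exprSr.
by elim: (p.-1 - i)%N => [|j /= ->]; rewrite ?mul1r // exprS -!mulrA.
Qed.

(** Both sides are the coefficient of X^i in the derivative of q^p, which is
    (ad q)^(p-1) applied to the derivative a of q. *)
Lemma coef_exp_linear_pchar (R : nzRingType) p (a b : R) i (q : {poly R}) :
    p \in [pchar R] -> q = a *: 'X + b%:P ->
  (q ^+ p)`_i.+1 *+ i.+1 = (iter p.-1 (fun r => q * r - r * q) a%:P)`_i.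
Proof.
move=> pR defq; rewrite -coef_deriv deriv_exp_sum.
rewrite iter_commutator_pred_pchar ?pchar_poly //.
by rewrite {2}defq derivD derivZ derivX derivC addr0 alg_polyC.
Qed.

(** Evaluation at 1 is compatible with products since 1 is central. *)
Lemma exprD_coef_linear (R : nzRingType) n (a b : R) (q : {poly R}) :
    (0 < n)%N -> q = a *: 'X + b%:P ->
  (a + b) ^+ n = a ^+ n + b ^+ n + \sum_(1 <= i < n) (q ^+ n)`_i.
Proof.
move=> n_gt0 defq.
have q1 : (q ^+ n).[1] = (a + b) ^+ n.
  rewrite horner_exp_comm ?defq ?hornerD ?hornerZ ?hornerX ?hornerC ?mulr1 //.
  by rewrite /comm_poly mul1r mulr1.
have sz_q : (size q <= 2)%N.
  rewrite defq -mul_polyC size_MXaddC; case: ifP => // _.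
  by rewrite ltnS size_polyC_leq1.
have sz_qX m : (size (q ^+ m) <= m.+1)%N.
  apply: leq_trans (size_poly_exp_leq _ _) _.
  rewrite ltnS -[leqRHS]mul1n leq_mul2r; apply/orP; right.
  by case: (size q) sz_q.
have qX0 : (q ^+ n)`_0 = b ^+ n.
  elim: (n) => [|m IHm]; first by rewrite coef1.
  by rewrite !exprS coef0M IHm defq coefD coefZ coefX coefC mulr0 add0r.
have qXn : (q ^+ n)`_n = a ^+ n.
  elim: (n) => [|m IHm]; first by rewrite coef1.
  have -> : q ^+ m.+1 = a%:P * (q ^+ m * 'X) + b%:P * q ^+ m.
    by rewrite commr_polyX mulrA -mulrDl mul_polyC -defq exprS.
  rewrite exprS coefD !coefCM coefMX IHm.
  by rewrite (nth_default _ (sz_qX m)) mulr0 addr0.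
rewrite -q1 (horner_coef_wide _ (sz_qX n)).
under eq_bigr => i _ do rewrite expr1n mulr1.
rewrite -(big_mkord xpredT (fun i => (q ^+ n)`_i)) big_nat_recr //= qXn.
by rewrite big_ltn // qX0 addrC addrA.
Qed.

(** * Associative algebras without unit *)

Lemma mulrn_pchar_lmod (k : fieldType) (V : lmodType k) p (v : V) :
  p \in [pchar k] -> v *+ p = 0.
Proof. by move=> pk; rewrite -scaler_nat (pcharf0 pk) scale0r. Qed.

Section AssociativeAlgebra.
Variables (k : fieldType) (D : lmodType k) (op : D -> D -> D).
Hypotheses (op_bil : is_bilinear op) (opA : associative op).

HB.instance Definition _ :=
  bilinear_isBilinear.Build k D D D *:%R *:%R op op_bil.

(** The ring k + D in which k acts by scalars. The proofs are arguments of the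
    type so that its ring structure can be inferred from it. *)
Definition unitization of is_bilinear op & associative op : Type :=
  (k^o * D)%type.
Local Notation A := (unitization op_bil opA).

HB.instance Definition _ := GRing.Lmodule.copy A (k^o * D)%type.

Definition unitization_mul (u v : A) : A :=
  (u.1 * v.1, u.1 *: v.2 + v.1 *: u.2 + op u.2 v.2).

Fact unitization_mulA : associative unitization_mul.
Proof.
move=> [a x] [b y] [c z]; congr pair => /=; first by rewrite mulrA.
rewrite !(linearDl, linearDr, linearZl_LR, linearZr_LR) /= !scalerDr !scalerA.
rewrite opA (mulrC c a) (mulrC b c).
rewrite -!addrA; do 2!congr (_ + _); rewrite [LHS]addrCA; congr (_ + _).
by rewrite [RHS]addrCA; congr (_ + _); rewrite [LHS]addrCA.
Qed.

Fact unitization_mul1r : left_id (1, 0) unitization_mul.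
Proof.
move=> [a x]; congr pair; rewrite /= ?mul1r //.
by rewrite linear0l scale1r scaler0 !addr0.
Qed.

Fact unitization_mulr1 : right_id (1, 0) unitization_mul.
Proof.
move=> [a x]; congr pair; rewrite /= ?mulr1 //.
by rewrite linear0r scale1r scaler0 addr0 add0r.
Qed.

Fact unitization_mulDl : left_distributive unitization_mul +%R.
Proof.
move=> [a x] [b y] [c z]; apply: injective_projections => /=.
  by rewrite mulrDl.
rewrite linearDl scalerDl scalerDr /=.
by rewrite [in RHS]addrACA [in X in _ = X + _]addrACA.
Qed.

Fact unitization_mulDr : right_distributive unitization_mul +%R.
Proof.
move=> [a x] [b y] [c z]; apply: injective_projections => /=.
  by rewrite mulrDr.
rewrite linearDr scalerDl scalerDr /=.
by rewrite [in RHS]addrACA [in X in _ = X + _]addrACA.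
Qed.

Fact unitization_1neq0 : (1, 0) != 0 :> A.
Proof. by apply/eqP=> -[/eqP]; rewrite oner_eq0. Qed.

HB.instance Definition _ := GRing.Zmodule_isNzRing.Build A unitization_mulA
  unitization_mul1r unitization_mulr1 unitization_mulDl unitization_mulDr
  unitization_1neq0.

Definition to_unitization (x : D) : A := (0, x).
Local Notation i := to_unitization.

Lemma to_unitization_is_linear : linear i.
Proof. by move=> a x y; congr pair => /=; rewrite scaler0 addr0. Qed.
HB.instance Definition _ :=
  GRing.isLinear.Build k D A *:%R i to_unitization_is_linear.

Lemma to_unitization_inj : injective i. Proof. by move=> x y []. Qed.

Lemma to_unitizationM x y : i (op x y) = i x * i y.
Proof. by congr pair; rewrite /= ?mul0r // !scale0r !add0r. Qed.

Lemma to_unitizationX n x : (0 < n)%N -> i (op_pow op n x) = i x ^+ n.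
Proof.
case: n => // n _; rewrite /op_pow iteropS.
by elim: n => //= n IHn; rewrite exprS to_unitizationM IHn.
Qed.

Lemma unitization_pchar p : p \in [pchar k] -> p \in [pchar A].
Proof.
move=> pk; rewrite inE (pcharf_prime pk) /= -scaler_nat (pcharf0 pk).
by rewrite scale0r.
Qed.

(** Both sides are Cauchy products, which is what carries the coefficient
    sequences defining the s_i over to polynomials. *)
Lemma coef_commutator (lie : D -> D -> D) (q r : {poly A}) u v :
    lie =2 lie_of op ->
    (forall n, q`_n = i (u n)) -> (forall n, r`_n = i (v n)) ->
  forall n, (q * r - r * q)`_n = i (vpoly_ext lie u v n).
Proof.
move=> lieE qu rv n; rewrite coefB coefM coefMr -sumrB raddf_sum.
by apply: eq_bigr => j _; rewrite qu rv -!to_unitizationM lieE raddfB.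
Qed.

(** The bracket is only required to agree pointwise with the commutator of the
    associative product, because brackets defined by other means, such as the
    one of a pre-Lie product, may coincide with it. *)
Lemma jacobson_formula (lie : D -> D -> D) p (x y : D) :
    lie =2 lie_of op -> p \in [pchar k] ->
  op_pow op p (x + y) = op_pow op p x + op_pow op p y +
    \sum_(1 <= j < p) jacobson_s lie p j x y.
Proof.
move=> lieE pk; have pA := unitization_pchar pk.
have p_gt0 := prime_gt0 (pcharf_prime pk).
apply: to_unitization_inj; rewrite [RHS]raddfD [in RHS]raddfD raddf_sum.
pose q := i x *: 'X + (i y)%:P.
rewrite /= !to_unitizationX // raddfD (exprD_coef_linear (q := q)) //.
congr (_ + _); apply: eq_big_nat => -[|j] // /andP[_ ltjp].
have j_neq0 : j.+1%:R != 0 :> k.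
  rewrite -(dvdn_pcharf pk); apply: contraL ltjp => /dvdn_leq.
  by rewrite -leqNgt; apply.
apply: (scalerI j_neq0).
rewrite -linearZ /= scalerA mulfV // scale1r scaler_nat.
rewrite (coef_exp_linear_pchar j pA (erefl q)) /jacobson_poly.
(* The iterated brackets agree coefficient by coefficient, for any number of
   brackets and in every degree. *)
elim: p.-1 j {ltjp j_neq0} => [|m IHm] n /=.
  by rewrite coefC /vpoly_const; case: eqP; rewrite ?raddf0.
apply: coef_commutator => // -[|[|l]]; rewrite coefD coefZ coefX coefC /=.
- by rewrite mulr0 add0r.
- by rewrite mulr1 addr0.
- by rewrite mulr0 addr0 raddf0.
Qed.

Lemma op_powZ n (a : k) x : op_pow op n (a *: x) = a ^+ n *: op_pow op n x.
Proof.
case: n => [|n]; first by rewrite /op_pow scaler0.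
rewrite /op_pow !iteropS; elim: n => [|n /= ->]; first by rewrite expr1.
by rewrite linearZl_LR linearZr_LR /= scalerA -exprS.
Qed.

Lemma op_pow_mull n x y : (0 < n)%N -> op (op_pow op n x) y = iter n (op x) y.
Proof.
case: n => // n _; rewrite /op_pow iteropS.
by elim: n => // n IHn; rewrite iterS -opA IHn.
Qed.

Lemma op_pow_mulr n x y :
  (0 < n)%N -> op y (op_pow op n x) = iter n (op^~ x) y.
Proof.
case: n => // n _; rewrite /op_pow iteropS.
by elim: n y => // n IHn y; rewrite iterS opA IHn -iterSr.
Qed.

Lemma iter_lie_of_pchar p x y : p \in [pchar k] ->
  iter p (lie_of op x) y = lie_of op (op_pow op p x) y.
Proof.
move=> pk; have p_prime := pcharf_prime pk.
have killD (v : D) := mulrn_pchar_lmod v pk.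
pose b : {bilinear D -> D -> D} := op.
have LRC w : b x (applyr b x w) = applyr b x (b x w) by rewrite /= opA.
rewrite (iterB_pchar p_prime killD (f := b x) (g := applyr b x)) //.
by rewrite /lie_of op_pow_mull ?op_pow_mulr ?prime_gt0.
Qed.

End AssociativeAlgebra.

(** * Dendriform algebras *)

Section Dendriform.
Variables (k : fieldType) (D : lmodType k) (prec succ : D -> D -> D).
Hypothesis dendD : is_dendriform prec succ.

HB.instance Definition _ := bilinear_isBilinear.Build k D D D *:%R *:%R prec
  (dend_prec_bilinear dendD).
HB.instance Definition _ := bilinear_isBilinear.Build k D D D *:%R *:%R succ
  (dend_succ_bilinear dendD).
Local Notation star := (dend_star prec succ).
Local Notation brace := (dend_brace prec succ).

Lemma dend_star_bilinear : is_bilinear star.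
Proof.
rewrite /dend_star; split=> [y a x x'|x a y y'] /=.
  by rewrite !linearPl /= scalerDr addrACA.
by rewrite !linearPr /= scalerDr addrACA.
Qed.

Lemma dend_brace_bilinear : is_bilinear brace.
Proof.
rewrite /dend_brace; split=> [y a x x'|x a y y'] /=.
  by rewrite linearPl linearPr /= scalerBr opprD addrACA.
by rewrite linearPl linearPr /= scalerBr opprD addrACA.
Qed.

HB.instance Definition _ := bilinear_isBilinear.Build k D D D *:%R *:%R star
  dend_star_bilinear.

Lemma dend_starA : associative star.
Proof.
move=> x y z; rewrite /dend_star (linearDl prec) /= (dend_prec_prec dendD).
by rewrite (dend_succ_prec dendD) (dend_succ_succ dendD) (linearDr succ) addrA.
Qed.

Lemma lie_of_dend_brace x y : lie_of brace x y = lie_of star x y.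
Proof.
rewrite /lie_of /dend_brace /dend_star opprB opprD [LHS]addrACA.
by rewrite (addrC (succ x y)).
Qed.

HB.instance Definition _ := bilinear_isBilinear.Build k D D D *:%R *:%R brace
  dend_brace_bilinear.

(** The left multiplications of the brace represent the commutator of star:
    {x, -} = L_x - R_x, where L_x and R_y commute, L is a morphism for star and
    R an antimorphism. *)
Lemma dend_brace_lie x y z :
  brace (lie_of star x y) z = brace x (brace y z) - brace y (brace x z).
Proof.
rewrite /lie_of linearBl /= /dend_brace /dend_star.
rewrite !(dend_succ_succ dendD) -!(dend_prec_prec dendD).
rewrite (linearBr succ) (linearBl prec) (linearBr succ) (linearBl prec) /=.
rewrite !(dend_succ_prec dendD).
by rewrite !opprB [RHS]addrACA !subrKA.
Qed.

Lemma dend_brace_left_sym x y z :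
  brace x (brace y z) - brace (brace x y) z =
  brace y (brace x z) - brace (brace y x) z.
Proof.
have := dend_brace_lie x y z.
rewrite -lie_of_dend_brace /lie_of linearBl => /eqP.
rewrite eq_sym subr_eq => /eqP ->.
by rewrite addrAC [X in X + _]addrAC subrr add0r addrC.
Qed.

Lemma dend_prec_op_pow n x y :
  (0 < n)%N -> prec y (op_pow star n x) = iter n (prec^~ x) y.
Proof.
case: n => // n _; rewrite /op_pow iteropS.
by elim: n y => // n IHn y; rewrite iterS -(dend_prec_prec dendD) IHn -iterSr.
Qed.

Lemma dend_succ_op_pow n x y :
  (0 < n)%N -> succ (op_pow star n x) y = iter n (succ x) y.
Proof.
case: n => // n _; rewrite /op_pow iteropS.
by elim: n => // n IHn; rewrite iterS (dend_succ_succ dendD) IHn.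
Qed.

Lemma iter_dend_brace_pchar p x y : p \in [pchar k] ->
  iter p (brace x) y = brace (op_pow star p x) y.
Proof.
move=> pk; have p_prime := pcharf_prime pk.
have killD (v : D) := mulrn_pchar_lmod v pk.
pose l : {bilinear D -> D -> D} := succ.
pose r : {bilinear D -> D -> D} := prec.
have lrC w : l x (applyr r x w) = applyr r x (l x w).
  by rewrite /= (dend_succ_prec dendD).
rewrite (iterB_pchar p_prime killD (f := l x) (g := applyr r x)) //.
by rewrite /dend_brace dend_succ_op_pow ?dend_prec_op_pow ?prime_gt0.
Qed.

End Dendriform.

Theorem theorem2p12 (k : fieldType) (p : nat) (p_char : p \in [pchar k])
    (D : lmodType k) (prec succ : D -> D -> D)
    (dendD : is_dendriform prec succ) :
  is_restricted_prelie p (dend_brace prec succ)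
    (op_pow (dend_star prec succ) p).
Proof.
have lieE := lie_of_dend_brace prec succ.
have star_bil := dend_star_bilinear dendD.
have starA := dend_starA dendD.
split.
- by split; [apply: dend_brace_bilinear | apply: dend_brace_left_sym].
- by move=> a x; apply: op_powZ.
- by move=> x y; rewrite iter_dend_brace_pchar.
- move=> x y; rewrite (eq_iter (lieE x)) iter_dend_brace_pchar //.
  by rewrite iter_lie_of_pchar // -lieE /lie_of subKr.
- by move=> x y; apply: jacobson_formula.
Qed.
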